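(* Consider a tree-FRCVP-pause instance with $\lambda=\infty$ (no platoon capacity) whose route graph is a polytree with reference node $r$, and let (DT) be the associated discrete-time mixed-integer linear program. Let $(\hat{x}^*,\hat{p}^*,\hat{y}^*,\hat{y}'^*,\hat{w}^* )$ be an optimal solution of (DT), and define, for every $u\in\mathcal{V}$ and $e=(n_1,n_2)\in\mathcal{R}_u$, $$\hat{\tau}^*_{u,e}=\underline{t}-\widetilde{T}_{n_1,r},$$ where $t=[\underline{t},\overline{t}]$ is the unique time bucket with $\hat{x}^*_{u,e,t}=1$. Then $\{\hat{\tau}^*_{u,e}:u\in\mathcal{V},\,e\in\mathcal{R}_u\}$, where $\hat{\tau}^*_{u,e}$ is the departure time of $u$ from the starting node of $e$, is an optimal solution of the tree-FRCVP-pause instance.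
   Context: **Problem.** A tree-FRCVP-pause instance has a finite set $\mathcal{V}$ of vehicles. Each $v\in\mathcal{V}$ has an origin $O_v$, a destination $D_v$, an earliest departure time $T^O_v$, an arrival deadline $T^D_v$, and a given route $\mathcal{R}_v$ (a set of arcs forming a directed path from $O_v$ to $D_v$). Let $\mathcal{R}=\bigcup_v\mathcal{R}_v$ be the set of all arcs and $\mathcal{V}_e=\{v:e\in\mathcal{R}_v\}$. Each arc $e$ has a travel time $T_e>0$ and a fuel cost $C_e>0$, the same for all vehicles. The fuel saving rates are constants $\sigma^l,\sigma^f>0$ for lead and trailing vehicles, and $\alpha_{\mathrm{eng}}\ge0$ is the fuel cost of restarting a vehicle after a stop. The route graph $\mathcal{G}$ (union of the routes) is a polytree, i.e., its undirected counterpart is a tree. The instance is irreducible: there is no partition $(\mathcal{V}_1,\mathcal{V}_2)$ of $\mathcal{V}$ into nonempty parts with $(\bigcup_{v\in\mathcal{V}_1}\mathcal{R}_v)\cap(\bigcup_{v\in\mathcal{V}_2}\mathcal{R}_v)=\emptyset$ (as arc sets). Vehicles may stop and wait any amount of time at any intermediate nodes of their routes. A solution is given by $\tau=\{\tau_{u,e}:u\in\mathcal{V},e\in\mathcal{R}_u\}$, where $\tau_{u,e}$ is the departure time of $u$ from the starting node of $e$. It is feasible if, for every $u$: $\tau_{u,e}\ge T^O_u$ for the first arc $e$ of $\mathcal{R}_u$; $\tau_{u,e'}\ge\tau_{u,e}+T_e$ for consecutive arcs $e,e'$ of $\mathcal{R}_u$; and $\tau_{u,e}+T_e\le T^D_u$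 for the last arc $e$. If $\tau_{u,e'}>\tau_{u,e}+T_e$ for consecutive arcs, then $u$ makes an intermediate stop at the node between them. All vehicles sharing an arc $e$ and departing from its starting node at the same instant form one platoon on $e$ (no capacity limit). In a platoon of size $m\ge2$ on $e$, the lead vehicle saves $\sigma^lC_e$ and each of the $m-1$ trailing vehicles saves $\sigma^fC_e$; a single vehicle saves nothing. The objective is to maximize the total fuel saving minus $\alpha_{\mathrm{eng}}$ times the total number of intermediate stops. **Relative time windows and buckets.** The reference node $r$ is an arbitrary fixed node of $\mathcal{G}$. For a node $s$, the arcs on the undirected path between $s$ and $r$ are split into those pointing in the direction from $s$ to $r$, $P^{\mathcal{G}}_{s\to r}$, and those pointing in the direction from $r$ to $s$, $P^{\mathcal{G}}_{r\to s}$; put $\widetilde{T}_{s,r}=\sum_{e\in P^{\mathcal{G}}_{s\to r}}T_e-\sum_{e\in P^{\mathcal{G}}_{r\to s}}T_e$. Let $\underline{t}_{v,O_v}=T^O_v$ and $\overline{t}_{v,O_v}=T^D_v-\sum_{e\in\mathcal{R}_v}T_e$ (assume $\underline{t}_{v,O_v}\le\overline{t}_{v,O_v}$), and $\mathrm{RTW}_v=[\underline{t}_{v,O_v}+\widetilde{T}_{O_v,r},\overline{t}_{v,O_v}+\widetilde{T}_{O_v,r}]$. Sort the list of all $2|\mathcal{V}|$ endpoints of the RTWs, keeping duplicates, as $a_1\le\dots\le a_{2|\mathcal{V}|}$. The sorted collection $\mathcal{S}$ of time buckets consists of those $[a_k,a_{k+1}]$, in this order, contained in $\mathrm{RTW}_m$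 for some $m\in\mathcal{V}$; $\mathcal{S}_u$ is the set of buckets contained in $\mathrm{RTW}_u$. The relation $\prec$ denotes strict precedence, of buckets in $\mathcal{S}$ or of arcs along a route. **Formulation (DT).** Maximize $$\sum_{e\in\mathcal{R}}\sum_{t\in\mathcal{S}}(\sigma^lC_ey'_{e,t}+\sigma^fC_ew_{e,t})-\alpha_{\mathrm{eng}}\sum_{u\in\mathcal{V}}\Big(\sum_{t\in\mathcal{S}_u}p_{u,t}-1\Big)$$ subject to (a variable $x_{u,e,t}$ exists only for $e\in\mathcal{R}_u$, $t\in\mathcal{S}_u$, and sums range over existing variables): - $\sum_{t\in\mathcal{S}_u}x_{u,e,t}=1$ for all $u\in\mathcal{V}$, $e\in\mathcal{R}_u$; - $x_{u,e',s}\le1-x_{u,e,t}$ for all $u\in\mathcal{V}$, $e\prec e'$ in $\mathcal{R}_u$, $s\prec t$ in $\mathcal{S}_u$; - $p_{u,t}\ge x_{u,e,t}$ for all $u\in\mathcal{V}$, $e\in\mathcal{R}_u$, $t\in\mathcal{S}_u$; - $\sum_{u\in\mathcal{V}_e}x_{u,e,t}\ge2y'_{e,t}$ for all $e\in\mathcal{R}$, $t\in\mathcal{S}$; - $y_{e,t}\ge x_{u,e,t}$ for all $e\in\mathcal{R}$, $u\in\mathcal{V}_e$, $t\in\mathcal{S}_u$; - $w_{e,t}=\sum_{u\in\mathcal{V}_e}x_{u,e,t}-y_{e,t}$ for all $e\in\mathcal{R}$, $t\in\mathcal{S}$; - $x_{u,e,t},p_{u,t},y_{e,t},y'_{e,t}\in\{0,1\}$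 and $w_{e,t}\ge0$.
   Formalization: The formal theorem adds the assumption σ^l ≤ σ^f; for any σ^l > σ^f the claim fails, e.g. one arc, four identical vehicles, α_eng = 0, two pairs placed in two buckets with the same lower endpoint. *)

(* Defs.v *)
From mathcomp Require Import all_boot all_order all_algebra.

Set Implicit Arguments.
Unset Strict Implicit.
Unset Printing Implicit Defensive.

Import Order.TTheory GRing.Theory Num.Theory.
Local Open Scope ring_scope.

(* Nodes are the elements of N, vehicles those of V, and an arc from n1 to n2
   is the pair (n1, n2).  A route is the sequence of its arcs in travel order.
   [travel] and [cost] only matter on arcs of the route graph. *)
Record instance (R : realFieldType) (N V : finType) := Instance {
  orig : V -> N;
  dest : V -> N;
  tdep : V -> R;            (* earliest departure time T^O *)
  tarr : V -> R;            (* arrival deadline T^D *)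
  route : V -> seq (N * N);
  travel : N * N -> R;
  cost : N * N -> R;
  sigma_l : R;
  sigma_f : R;
  alpha_eng : R
}.

(* unzip2 s lists the heads of the arcs, so o :: unzip2 s is the list of
   visited nodes; the tails of the arcs must be that list minus its last item *)
Definition dipath (N : eqType) (o d : N) (s : seq (N * N)) : bool :=
  [&& unzip1 s == belast o (unzip2 s), last o (unzip2 s) == d
    & uniq (o :: unzip2 s)].

Section Instance.

Variables (R : realFieldType) (N V : finType) (I : instance R N V).

Definition arcs_of (A : {set V}) : {set N * N} :=
  \bigcup_(v in A) [set e in route I v].

Definition arcs : {set N * N} := arcs_of [set: V].

Definition users (e : N * N) : {set V} := [set v | e \in route I v].

Definition gnodes : {set N} :=
  [set n | [exists v, n \in orig I v :: unzip2 (route I v)]].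

Definition uadj : rel N := [rel a b | ((a, b) \in arcs) || ((b, a) \in arcs)].

(* The first clause excludes 2-cycles of the undirected counterpart, which
   uadj would merge into one edge; longer cycles have at least three nodes. *)
Definition polytree : Prop :=
  [/\ forall a b, (a, b) \in arcs -> (b, a) \notin arcs,
      {in gnodes &, forall a b, connect uadj a b}
    & forall c : seq N, (2 < size c)%N -> ~ ucycle uadj c].

Definition irreducible : Prop :=
  forall V1 V2 : {set V},
    V1 != set0 -> V2 != set0 -> V1 :|: V2 = [set: V] -> V1 :&: V2 = set0 ->
    arcs_of V1 :&: arcs_of V2 <> set0.

Record valid_instance : Prop := ValidInstance {
  travel_gt0 : forall e, e \in arcs -> 0 < travel I e;
  cost_gt0 : forall e, e \in arcs -> 0 < cost I e;
  sigma_l_gt0 : 0 < sigma_l I;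
  sigma_f_gt0 : 0 < sigma_f I;
  alpha_eng_ge0 : 0 <= alpha_eng I;
  route_dipath : forall v, dipath (orig I v) (dest I v) (route I v);
  graph_polytree : polytree;
  instance_irreducible : irreducible;
  window_nonempty :
    forall v, tdep I v <= tarr I v - \sum_(e <- route I v) travel I e
}.

(* A solution assigns to u and e the departure time of u from the starting
   node of e; values at e outside the route of u are irrelevant. *)

Definition consecutive (u : V) : seq ((N * N) * (N * N)) :=
  zip (route I u) (behead (route I u)).

Record feasible (tau : V -> N * N -> R) : Prop := Feasible {
  feas_first : forall u e s, route I u = e :: s -> tdep I u <= tau u e;
  feas_next : forall u e e', (e, e') \in consecutive u ->
    tau u e + travel I e <= tau u e';
  feas_last : forall u s e, route I u = rcons s e ->
    tau u e + travel I e <= tarr I u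
}.

Definition stops (tau : V -> N * N -> R) (u : V) : nat :=
  count (fun q => tau u q.1 + travel I q.1 < tau u q.2) (consecutive u).

Definition platoons (tau : V -> N * N -> R) (e : N * N) : {set {set V}} :=
  preim_partition (fun u => tau u e) (users e).

Definition platoon_saving (e : N * N) (m : nat) : R :=
  if (2 <= m)%N
  then sigma_l I * cost I e + sigma_f I * cost I e * (m - 1)%N%:R
  else 0.

Definition objective (tau : V -> N * N -> R) : R :=
  \sum_(e in arcs) \sum_(P in platoons tau e) platoon_saving e #|P|
  - alpha_eng I * (\sum_(u : V) stops tau u)%N%:R.

Definition optimal (tau : V -> N * N -> R) : Prop :=
  feasible tau /\
  forall tau', feasible tau' -> objective tau' <= objective tau.

(* Undirected simple path visiting the nodes s :: p, from s to r. *)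
Definition upath (s r : N) (p : seq N) : bool :=
  [&& path uadj s p, last s p == r & uniq (s :: p)].

Definition steps (s : N) (p : seq N) : seq (N * N) := zip (s :: p) p.

(* Bounding the length of p by #|N| loses no simple path. *)
Definition arcs_toward (s r : N) : {set N * N} :=
  [set e in arcs | [exists p : #|N|.-bseq N,
     upath s r p && (e \in steps s p)]].

Definition arcs_away (s r : N) : {set N * N} :=
  [set e in arcs | [exists p : #|N|.-bseq N,
     upath s r p && ((e.2, e.1) \in steps s p)]].

Definition rel_time (s r : N) : R :=
  \sum_(e in arcs_toward s r) travel I e
  - \sum_(e in arcs_away s r) travel I e.

Section Buckets.

Variable r : N.

Definition rtw_lo (v : V) : R := tdep I v + rel_time (orig I v) r.

Definition rtw_hi (v : V) : R :=
  tarr I v - \sum_(e <- route I v) travel I e + rel_time (orig I v) r.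

Definition endpoints : seq R :=
  sort <=%R ([seq rtw_lo v | v <- enum V] ++ [seq rtw_hi v | v <- enum V]).

(* Index k : 'I_(2 * #|V| - 1) stands for the interval between the k-th and
   (k+1)-st sorted endpoints, counting from 0.  Buckets are indices rather than
   intervals, so equal (degenerate) intervals coming from repeated endpoints
   remain distinct members of the collection, ordered by their index. *)
Definition slot (W : finType) := 'I_(2 * #|W| - 1).

Definition slot_lo (k : slot V) : R := nth 0 endpoints k.

Definition slot_hi (k : slot V) : R := nth 0 endpoints k.+1.

Definition buckets_of (u : V) : {set slot V} :=
  [set k | (rtw_lo u <= slot_lo k) && (slot_hi k <= rtw_hi u)].

Definition buckets : {set slot V} := [set k | [exists m, k \in buckets_of m]].

End Buckets.

End Instance.

(* dx u e t is a variable only for e on the route of u and t in the buckets of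
   u, and similarly for the other components; other values are never read. *)
Record dt_solution (R : realFieldType) (N V : finType) := DTSolution {
  dx : V -> N * N -> slot V -> R;
  dp : V -> slot V -> R;
  dy : N * N -> slot V -> R;
  dy' : N * N -> slot V -> R;
  dw : N * N -> slot V -> R
}.

Definition binary (R : realFieldType) (z : R) : Prop := z = 0 \/ z = 1.

Section DT.

Variables (R : realFieldType) (N V : finType) (I : instance R N V) (r : N).

Definition load (s : dt_solution R N V) (e : N * N) (t : slot V) : R :=
  \sum_(u in users I e | t \in buckets_of I r u) dx s u e t.

Record dt_feasible (s : dt_solution R N V) : Prop := DTFeasible {
  dt_assign : forall u e, e \in route I u ->
    \sum_(t in buckets_of I r u) dx s u e t = 1;
  dt_order : forall u e e' (t t' : slot V),
    e \in route I u -> e' \in route I u ->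
    (index e (route I u) < index e' (route I u))%N ->
    t \in buckets_of I r u -> t' \in buckets_of I r u -> (t' < t)%N ->
    dx s u e' t' <= 1 - dx s u e t;
  dt_visit : forall u e t, e \in route I u -> t \in buckets_of I r u ->
    dx s u e t <= dp s u t;
  dt_platoon : forall e t, e \in arcs I -> t \in buckets I r ->
    2%:R * dy' s e t <= load s e t;
  dt_used : forall e u t,
    e \in arcs I -> u \in users I e -> t \in buckets_of I r u ->
    dx s u e t <= dy s e t;
  dt_trailing : forall e t, e \in arcs I -> t \in buckets I r ->
    dw s e t = load s e t - dy s e t;
  dt_x_bin : forall u e t, e \in route I u -> t \in buckets_of I r u ->
    binary (dx s u e t);
  dt_p_bin : forall u t, t \in buckets_of I r u -> binary (dp s u t);
  dt_y_bin : forall e t, e \in arcs I -> t \in buckets I r ->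
    binary (dy s e t);
  dt_y'_bin : forall e t, e \in arcs I -> t \in buckets I r ->
    binary (dy' s e t);
  dt_w_ge0 : forall e t, e \in arcs I -> t \in buckets I r -> 0 <= dw s e t
}.

Definition dt_objective (s : dt_solution R N V) : R :=
  \sum_(e in arcs I) \sum_(t in buckets I r)
     (sigma_l I * cost I e * dy' s e t + sigma_f I * cost I e * dw s e t)
  - alpha_eng I *
    \sum_(u : V) (\sum_(t in buckets_of I r u) dp s u t - 1).

Definition dt_optimal (s : dt_solution R N V) : Prop :=
  dt_feasible s /\
  forall s', dt_feasible s' -> dt_objective s' <= dt_objective s.

(* The default 0 is only reached when no bucket is assigned to u on e, which
   dt_feasible rules out for e on the route of u. *)
Definition dt_departure (s : dt_solution R N V) (u : V) (e : N * N) : R :=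
  if [pick t in buckets_of I r u | dx s u e t == 1] is Some t
  then slot_lo I r t - rel_time I e.1 r
  else 0.

End DT.

(* Main.v *)
Require Import Defs.
From mathcomp Require Import all_boot all_order all_algebra.
From mathcomp Require Import zify ring lra.

(** In a polytree the undirected path from a node to [r] is unique, so the
    relative time of a node is a potential: along every arc [(a, b)] it drops
    by exactly the travel time ([rel_time_arc]).  Measure departures by
    [rel_departure], i.e. departure time plus relative time of the starting
    node.  Travelling leaves this quantity unchanged and waiting increases it:
    a schedule is feasible iff the relative departures of each vehicle are
    nondecreasing along its route and stay in its relative time window, two
    users of an arc are in one platoon iff their relative departures agree, and
    stops are the strict increases.

    The two problems are compared in both directions.  A solution of the
    discrete program assigns to each vehicle a nondecreasing sequence of
    buckets; departing at the lower ends of the buckets gives a feasible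
    schedule that is at least as good ([dt_objective_le]), since users of one
    bucket depart together, and changing bucket need not be a stop when the
    lower ends coincide.  Conversely, a
    feasible schedule is rounded by a single monotone map [bucket_index] from
    relative times to buckets, which lands in the buckets of [u] whenever its
    argument is in the window of [u]; this yields a solution of the program
    that is at least as good as the schedule ([feasible_dt]).  Chaining the two
    inequalities through the optimality of [s] gives the claim.

    Both comparisons replace the grouping of the users of an arc by a coarser
    one.  This never decreases the saving: the saving per member of a platoon
    is nondecreasing in its size because [sigma_l <= sigma_f]
    ([saving_share_mono]), and merging only enlarges the platoon of each user
    ([group_saving_coarser]).  Stops are compared with visited buckets through
    the number of distinct values of a sequence, which is at most one more than
    the number of its changes, and exactly one more if it is nondecreasing. *)

Set Implicit Arguments.
Unset Strict Implicit.
Unset Printing Implicit Defensive.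

Import Order.TTheory GRing.Theory Num.Theory.
Local Open Scope ring_scope.

(** * Simple paths of an acyclic symmetric relation *)

Section AcyclicRelation.

Variables (T : eqType) (e : rel T).
Hypothesis e_sym : symmetric e.
Hypothesis e_acyclic : forall c : seq T, (2 < size c)%N -> ~ ucycle e c.

(** Two distinct neighbours of [x] are not joined by a path avoiding [x], as it
    would close up to a cycle through [x]. *)
Lemma acyclic_detour x a p :
  e x a -> e x (last a p) -> path e a p -> x \notin a :: p -> last a p = a.
Proof.
move=> xa + ap xp; case/shortenP: ap => q aq uq sub xb; apply/eqP/negPn/negP => ab.
case: q ab aq uq sub xb => [|c q] ab aq uq sub xb; first by rewrite /= eqxx in ab.
apply: (e_acyclic (c := x :: a :: c :: q)) => //.
have xq : x \notin a :: c :: q.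
  apply: contra xp; rewrite !(inE, in_cons) => /orP[->//|xq].
  by rewrite sub ?orbT.
have xcq : path e x (rcons (a :: c :: q) x).
  by rewrite rcons_path [e _ x]e_sym xb andbT; apply/andP.
by apply/andP; split; [exact: xcq | rewrite cons_uniq xq].
Qed.

Lemma acyclic_simple_path_uniq x p q :
  path e x p -> path e x q -> last x p = last x q ->
  uniq (x :: p) -> uniq (x :: q) -> p = q.
Proof.
elim: p x q => [|a p IHp] x [|b q] //=.
- by move=> _ _ -> _ /andP[]; rewrite mem_last.
- by move=> _ _ <- /andP[]; rewrite mem_last.
move=> /andP[xa ap] /andP[xb bq] pq /andP[xp up] /andP[xq uq].
have ab : a = b.
  (* Going along one path and back along the other avoids x. *)
  have := @acyclic_detour x a (p ++ rev (belast b q)).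
  have lst : last a (p ++ rev (belast b q)) = b.
    rewrite last_cat pq; case: (q) => //= c q'.
    by rewrite rev_cons last_rcons.
  rewrite lst => H; apply/esym/H => //.
  - rewrite cat_path ap pq /= rev_path.
    by rewrite (@eq_path _ _ e) // => y z; exact: e_sym.
  - rewrite -cat_cons mem_cat mem_rev negb_or xp.
    by apply: contra xq => /mem_belast.
rewrite -ab in bq pq uq *; congr (_ :: _).
by apply: (IHp a).
Qed.

End AcyclicRelation.

(** * Relative times in a polytree *)

Section RelativeTime.

Variables (R : realFieldType) (N V : finType) (I : instance R N V).
Hypothesis hI : valid_instance I.

Lemma uadj_sym : symmetric (uadj I).
Proof. by move=> a b; rewrite /uadj /= orbC. Qed.

Lemma arc_uadj a b : (a, b) \in arcs I -> uadj I a b.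
Proof. by rewrite /uadj /= => ->. Qed.

Lemma arc_irrefl a : (a, a) \notin arcs I.
Proof.
have [h _ _] := graph_polytree hI.
by apply/negP => aa; move: (h _ _ aa); rewrite aa.
Qed.

Lemma mem_arcs v e : e \in route I v -> e \in arcs I.
Proof. by move=> ev; apply/bigcupP; exists v; rewrite ?inE. Qed.

Lemma arc_gnodes a b : (a, b) \in arcs I -> a \in gnodes I /\ b \in gnodes I.
Proof.
case/bigcupP => v _; rewrite inE => abv.
have /and3P[/eqP h1 _ _] := route_dipath hI v.
split; rewrite inE; apply/existsP; exists v; last first.
  by rewrite inE (map_f snd abv) orbT.
by apply: mem_belast; rewrite -h1 (map_f fst abv).
Qed.

Lemma upath_uniq x r p q : upath I x r p -> upath I x r q -> p = q.
Proof.
have [_ _ acyc] := graph_polytree hI.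
case/and3P => hp /eqP lp up /and3P[hq /eqP lq uq].
by apply: (acyclic_simple_path_uniq uadj_sym acyc hp hq) => //; rewrite lp lq.
Qed.

Lemma upath_exists x r :
  x \in gnodes I -> r \in gnodes I -> exists p, upath I x r p.
Proof.
have [_ conn _] := graph_polytree hI.
move=> /conn hx /hx /connectP[p xp ->].
by case/shortenP: xp => q xq uq _; exists q; rewrite /upath xq uq eqxx.
Qed.

Lemma upath_bseq x r p :
  upath I x r p -> exists p' : #|N|.-bseq N, p = p' :> seq N.
Proof.
case/and3P => _ _ u; have : (size p <= #|N|)%N.
  by rewrite ltnW // -[X in (X <= _)%N]/(size (x :: p)) -(card_uniqP u) max_card.
by move=> h; exists (Bseq h).
Qed.

Lemma arcs_towardE x r p :
  upath I x r p -> arcs_toward I x r = [set e in arcs I | e \in steps x p].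
Proof.
move=> hp; apply/setP => e; rewrite !inE; congr (_ && _).
apply/existsP/idP => [[q /andP[hq]]|ep]; first by rewrite (upath_uniq hp hq).
by case: (upath_bseq hp) => q pq; exists q; rewrite -pq hp.
Qed.

Lemma arcs_awayE x r p :
  upath I x r p ->
  arcs_away I x r = [set e in arcs I | (e.2, e.1) \in steps x p].
Proof.
move=> hp; apply/setP => e; rewrite !inE; congr (_ && _).
apply/existsP/idP => [[q /andP[hq]]|ep]; first by rewrite (upath_uniq hp hq).
by case: (upath_bseq hp) => q pq; exists q; rewrite -pq hp.
Qed.

Lemma steps_mem (x : N) p e : e \in steps x p -> e.1 \in x :: p.
Proof.
case: e => a b; rewrite /steps; elim: p x => //= y p IHp x; rewrite inE.
by case/orP => [/eqP[-> _]|/IHp h]; rewrite in_cons ?eqxx // h orbT.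
Qed.


Lemma upath_cons_toward a b r p :
  (a, b) \in arcs I -> upath I a r (b :: p) -> upath I b r p ->
  rel_time I a r = travel I (a, b) + rel_time I b r.
Proof.
move=> ab ha hb; have [asym _ _] := graph_polytree hI.
have na : a \notin b :: p by case/and3P: ha => _ _ /andP[].
rewrite /rel_time (arcs_towardE ha) (arcs_awayE ha).
rewrite (arcs_towardE hb) (arcs_awayE hb).
have -> : [set e in arcs I | e \in steps a (b :: p)] =
          (a, b) |: [set e in arcs I | e \in steps b p].
  by apply/setP => e; rewrite !inE; case: eqP => [->|_]; rewrite ?ab.
have -> : [set e in arcs I | (e.2, e.1) \in steps a (b :: p)] =
          [set e in arcs I | (e.2, e.1) \in steps b p].
  apply/setP => -[c d]; rewrite !inE /=; case: eqP => [[-> ->]|_] //=.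
  by rewrite (negbTE (asym _ _ ab)).
rewrite big_setU1 /= ?addrA // inE; apply/nandP; right.
by apply: contra na => /steps_mem.
Qed.

Lemma upath_cons_away a b r p :
  (a, b) \in arcs I -> upath I b r (a :: p) -> upath I a r p ->
  rel_time I a r = travel I (a, b) + rel_time I b r.
Proof.
move=> ab hb ha; have [asym _ _] := graph_polytree hI.
have nb : b \notin a :: p by case/and3P: hb => _ _ /andP[].
rewrite /rel_time (arcs_towardE ha) (arcs_awayE ha).
rewrite (arcs_towardE hb) (arcs_awayE hb).
have -> : [set e in arcs I | (e.2, e.1) \in steps b (a :: p)] =
          (a, b) |: [set e in arcs I | (e.2, e.1) \in steps a p].
  apply/setP => -[c d]; rewrite !inE -!pair_eqE /= [(d == b) && _]andbC.
  by case: (@andP (c == a) (d == b)) => [[/eqP -> /eqP ->]|_]; rewrite ?ab.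
have -> : [set e in arcs I | e \in steps b (a :: p)] =
          [set e in arcs I | e \in steps a p].
  apply/setP => -[c d]; rewrite !inE; case: ((c, d) =P (b, a)) => [[-> ->]|_] //.
  by rewrite (negbTE (asym _ _ ab)).
rewrite big_setU1 /=; first by ring.
by rewrite inE; apply/nandP; right; apply: contra nb => /steps_mem.
Qed.

(** The simple path from [a] to [r] either starts with the arc, or is what
    remains of the path from [b] after its first step, which goes to [a]. *)
Lemma rel_time_arc r a b :
  r \in gnodes I -> (a, b) \in arcs I ->
  rel_time I a r = travel I (a, b) + rel_time I b r.
Proof.
move=> hr ab; have [_ gb] := arc_gnodes ab.
have [_ _ acyc] := graph_polytree hI.
have ba : uadj I b a by rewrite uadj_sym arc_uadj.
have [p hp] := upath_exists gb hr.
case/and3P: (hp) => bp lp up.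
have [ap|nap] := boolP (a \in b :: p); last first.
  apply: (upath_cons_toward ab _ hp); apply/and3P; split => //.
    by rewrite /= arc_uadj.
  by rewrite cons_uniq nap.
have {}ap : a \in p.
  move: ap; rewrite inE => /orP[/eqP E|//].
  by move: ab; rewrite E (negbTE (arc_irrefl b)).
case: p ap hp bp lp up => // c p; rewrite inE => ap hp bp lp up.
(* If [a] came later than the first step, the stretch from [c] to [a] would
   join two neighbours of [b] without passing through [b]. *)
have ca : a = c.
  case/orP: ap => [/eqP//|ap].
  move: (bp) (up) => /= /andP[bc cp] /and3P[nbp ncp up'].
  case/splitPr: ap cp nbp => p1 p2; rewrite -cat_rcons cat_path => /andP[cp _] nbp.
  have := acyclic_detour uadj_sym acyc (x := b) (a := c) (p := rcons p1 a).
  rewrite last_rcons; apply => //.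
  by apply: contra nbp; rewrite -cat_cons mem_cat => ->.
rewrite -ca in hp bp lp up; apply: (upath_cons_away ab hp).
by move: bp up; rewrite /upath /= => /andP[_ ->] /andP[_ ->]; rewrite andbT.
Qed.

End RelativeTime.

(** * Savings as sums over vehicles *)

Section Saving.

Variables (R : realFieldType) (N V : finType) (I : instance R N V).
Hypothesis hI : valid_instance I.
Hypothesis hsigma : sigma_l I <= sigma_f I.

(** Saving per member of a platoon of size [m] (and 0 for [m = 0]). *)
Definition saving_share (e : N * N) (m : nat) : R :=
  platoon_saving I e m / m%:R.

Lemma saving_share_mono e m n :
  e \in arcs I -> (0 < m <= n)%N -> saving_share e m <= saving_share e n.
Proof.
move=> /(cost_gt0 hI) c0 /andP[m0 mn].
have sl0 := sigma_l_gt0 hI; have sf0 := sigma_f_gt0 hI.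
have M0 : 0 < m%:R :> R by rewrite ltr0n.
have N0 : 0 < n%:R :> R by rewrite ltr0n (leq_trans m0).
have MN : m%:R <= n%:R :> R by rewrite ler_nat.
have c1 : 0 <= sigma_l I * cost I e by rewrite mulr_ge0 // ltW.
have c2 : 0 <= sigma_f I * cost I e by rewrite mulr_ge0 // ltW.
have c12 : sigma_l I * cost I e <= sigma_f I * cost I e by rewrite ler_pM2r.
rewrite /saving_share /platoon_saving.
have [m2|m2] := leqP 2 m.
  rewrite (leq_trans m2 mn) ler_pdivrMr // [leRHS]mulrAC ler_pdivlMr //.
  by rewrite !natrB ?(leq_trans m0 mn) //; nra.
rewrite mul0r; case: ifP => n2; last by rewrite mul0r.
apply: divr_ge0; last exact: ltW.
by rewrite addr_ge0 // mulr_ge0.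
Qed.

Lemma saving_shareK e m : (m%:R * saving_share e m) = platoon_saving I e m.
Proof.
rewrite /saving_share; case: m => [|m]; first by rewrite mul0r.
by rewrite mulrC divfK // pnatr_eq0.
Qed.

(** Total saving on [e] when the users of [e] are grouped by the value of [f],
    every user being credited with an equal share of its group's saving. *)
Definition group_saving (A : eqType) (e : N * N) (f : V -> A) : R :=
  \sum_(u in users I e) saving_share e #|[set v in users I e | f v == f u]|.

Lemma group_saving_coarser (A B : eqType) e (f : V -> A) (g : V -> B) :
  e \in arcs I -> {in users I e &, forall u v, f u = f v -> g u = g v} ->
  group_saving e f <= group_saving e g.
Proof.
move=> he fg; apply: ler_sum => u ue; apply: saving_share_mono => //.
apply/andP; split.
  by rewrite card_gt0; apply/set0Pn; exists u; rewrite inE ue eqxx.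
apply: subset_leq_card; apply/subsetP => v; rewrite !inE => /andP[ve /eqP E].
by rewrite ve; apply/eqP/fg => //; rewrite inE.
Qed.

Lemma platoons_group_saving (tau : V -> N * N -> R) e :
  \sum_(P in platoons I tau e) platoon_saving I e #|P| =
  group_saving e (tau^~ e).
Proof.
have part := preim_partitionP (tau^~ e) (users I e).
rewrite /group_saving (set_partition_big _ part) /=; apply: eq_bigr => P hP.
rewrite -saving_shareK mulr_natl -sumr_const; apply: eq_bigr => u uP.
have [/eqP covP trivP _] := and3P part.
have PD : P \subset users I e by rewrite -covP bigcup_sup.
have ue := subsetP PD _ uP.
congr saving_share; apply: eq_card => v; rewrite [RHS]inE.
have [vD|vD] := boolP (v \in users I e); last first.
  by apply/negP => /(subsetP PD); rewrite (negbTE vD).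
rewrite [RHS]eq_sym -(def_pblock trivP hP uP).
rewrite pblock_equivalence_partition //.
by move=> x y z _ _ _; split=> // /eqP ->.
Qed.

Lemma slots_group_saving (n : nat) (B : {set 'I_n}) (b : V -> nat) e :
  (forall u, u \in users I e -> exists2 t, t \in B & b u = t :> nat) ->
  \sum_(t in B) platoon_saving I e #|[set v in users I e | b v == t :> nat]| =
  group_saving e b.
Proof.
move=> hb; rewrite /group_saving.
transitivity (\sum_(t in B) \sum_(u in users I e | b u == t :> nat)
   saving_share e #|[set v in users I e | b v == b u]|).
  apply: eq_bigr => t _; rewrite -saving_shareK mulr_natl -sumr_const.
  rewrite [in RHS](eq_bigl (mem [set v in users I e | b v == t])) /=; last first.
    by move=> u; rewrite !inE.
  by apply: eq_bigr => u; rewrite inE => /andP[_ /eqP ->].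
rewrite (exchange_big_dep (mem (users I e))) /=; last by move=> t u _ /andP[].
apply: eq_bigr => u ue; have [t tB bt] := hb _ ue.
rewrite (bigD1 t) /= ?tB ?ue ?bt ?eqxx //= big1 ?addr0 // => t'.
by case/andP => /andP[_ /eqP/val_inj ->]; rewrite eqxx.
Qed.

End Saving.

(** * Sequences: distinct values, changes and increases *)

Section Sequences.

Lemma size_undup_changes (T A : eqType) (g : T -> A) (s : seq T) :
  (size (undup (map g s)) <=
   count (fun q => g q.1 != g q.2) (zip s (behead s)) + (s != [::]))%N.
Proof.
case: s => // x s; elim: s x => [|y s IHs] x //.
move: (IHs y) => /=; rewrite !inE.
case: (g x =P g y) => [->|_] //=.
by case: (g y \in _); case: (g x \in _) => /=; lia.
Qed.

Lemma increases_size_undup (T : eqType) (f : T -> nat) (s : seq T) :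
  sorted leq (map f s) ->
  (count (fun q => f q.1 < f q.2) (zip s (behead s)) + (s != [::]) <=
   size (undup (map f s)))%N.
Proof.
case: s => // x s; elim: s x => [|y s IHs] x //.
rewrite /= => /andP[xy ys]; move: (IHs y ys) => /=.
have [fxy|fyx] := ltnP (f x) (f y).
  suff /negbTE -> : f x \notin f y :: map f s by rewrite /= add1n addSn ltnS.
  apply/negP => hx; have := order_path_min leq_trans ys => /allP h.
  move: hx; rewrite inE => /orP[/eqP E|/h]; lia.
have -> : f x = f y by lia.
by rewrite in_cons eqxx.
Qed.

Lemma sorted_zip (T : Type) (e : rel T) (s : seq T) :
  sorted e s = all (fun q => e q.1 q.2) (zip s (behead s)).
Proof. by case: s => // x s; elim: s x => //= y s IHs x; rewrite IHs. Qed.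

Lemma mem_consecutive (T : eqType) (s : seq T) x y :
  (x, y) \in zip s (behead s) -> x \in s /\ y \in s.
Proof.
elim: s => // a [|b s] IHs //; rewrite inE => /orP[/eqP[-> ->]|/IHs[h1 h2]].
  by rewrite !in_cons !eqxx /= orbT.
by rewrite ![_ \in a :: _]in_cons h1 h2 !orbT.
Qed.

Lemma consecutive_index (T : eqType) (s : seq T) x y :
  uniq s -> (x, y) \in zip s (behead s) -> (index x s < index y s)%N.
Proof.
elim: s => // a [|b s] IHs //; rewrite cons_uniq => /andP[an us].
rewrite inE => /orP[/eqP[-> ->]|h].
  by move: an; rewrite inE negb_or => /andP[/negbTE ab _] /=; rewrite eqxx ab.
have [hx hy] := mem_consecutive h; have := IHs us h.
have nx : a == x = false by apply: contraNF an => /eqP ->.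
have ny : a == y = false by apply: contraNF an => /eqP ->.
by rewrite /= nx ny ltnS.
Qed.

Lemma count_ltn (T : eqType) (p q : pred T) (s : seq T) x :
  (forall y, p y -> q y) -> x \in s -> q x -> ~~ p x ->
  (count p s < count q s)%N.
Proof.
move=> pq + qx px; elim: s => //= y s IHs.
have h : (count p s <= count q s)%N by apply: sub_count.
rewrite inE => /orP[/eqP <-|/IHs lt]; first by rewrite qx (negbTE px).
by case: (boolP (p y)) => [/pq ->|_]; lia.
Qed.

Lemma leq_in_count (T : eqType) (p q : pred T) (s : seq T) :
  {in s, forall x, p x -> q x} -> (count p s <= count q s)%N.
Proof.
move=> pq; rewrite (eq_in_count (a2 := predI p q)).
  by apply: sub_count => x /andP[].
by move=> x /pq h /=; case: (p x) h => // ->.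
Qed.

Lemma sorted_map_index disp (T : eqType) (A : orderType disp) (f : T -> A) s x y :
  sorted <=%O (map f s) -> x \in s -> y \in s ->
  (index x s <= index y s)%N -> (f x <= f y)%O.
Proof.
rewrite sorted_map => srt xs ys xy.
have := @sorted_leq_nth _ (relpre f <=%O) _ _ x s srt
  (index x s) (index y s).
rewrite /= !inE !index_mem !nth_index //; apply => //.
- by move=> a b c /=; exact: le_trans.
- by move=> a /=.
Qed.

End Sequences.

(** * Schedules in relative time *)

Section Routes.

Variables (R : realFieldType) (N V : finType) (I : instance R N V) (r : N).
Hypothesis hI : valid_instance I.
Hypothesis hr : r \in gnodes I.

(** Departure of [u] on [e], shifted by the relative time of the start of [e]. *)
Definition rel_departure (tau : V -> N * N -> R) (u : V) (e : N * N) : R :=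
  tau u e + rel_time I e.1 r.

Lemma mem_users u e : (u \in users I e) = (e \in route I u).
Proof. by rewrite inE. Qed.

(** The hypothesis is the first clause of [dipath]: [s] is a walk of arcs
    starting at [o]. *)
Lemma chain_consecutive (o : N) s e e' :
  unzip1 s == belast o (unzip2 s) -> (e, e') \in zip s (behead s) ->
  e.2 = e'.1.
Proof.
elim: s o => // a [|b s] IHs o //=.
rewrite eqseq_cons inE => /andP[_ h] /orP[/eqP[-> ->]|]; last exact: (IHs a.2).
by move: h; rewrite /= eqseq_cons => /andP[/eqP].
Qed.

Lemma chain_rel_time (o : N) s :
  unzip1 s == belast o (unzip2 s) -> {subset s <= arcs I} ->
  rel_time I o r =
    \sum_(e <- s) travel I e + rel_time I (last o (unzip2 s)) r.
Proof.
elim: s o => [|[a b] s IHs] o /=; first by rewrite big_nil add0r.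
rewrite eqseq_cons => /andP[/eqP <- hs] sub.
rewrite big_cons (rel_time_arc hI hr (b := b)) ?sub ?inE ?eqxx // -addrA.
by rewrite (IHs b) // => e es; rewrite sub // inE es orbT.
Qed.

Lemma route_uniq u : uniq (route I u).
Proof.
by have /and3P[_ _ /andP[_ /map_uniq]] := route_dipath hI u.
Qed.

Lemma route_first u e s : route I u = e :: s -> e.1 = orig I u.
Proof.
have /and3P[+ _ _] := route_dipath hI u.
by move=> + E; rewrite E /= eqseq_cons => /andP[/eqP].
Qed.

Lemma route_last u s e : route I u = rcons s e -> e.2 = dest I u.
Proof.
have /and3P[_ /eqP + _] := route_dipath hI u.
by move=> + E; rewrite E /unzip2 map_rcons last_rcons.
Qed.

Lemma rtw_hiE u : rtw_hi I r u = tarr I u + rel_time I (dest I u) r.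
Proof.
have /and3P[h /eqP hd _] := route_dipath hI u.
rewrite /rtw_hi (chain_rel_time h) ?hd; first by ring.
by move=> e; exact: mem_arcs.
Qed.

(** Relative departures of consecutive arcs differ by the waiting time. *)
Lemma rel_departure_next tau u e e' : (e, e') \in consecutive I u ->
  (rel_departure tau u e' - rel_departure tau u e =
   tau u e' - (tau u e + travel I e)).
Proof.
move=> h; have [eu _] := mem_consecutive h.
have /and3P[hc _ _] := route_dipath hI u.
rewrite /rel_departure -(chain_consecutive hc h).
move: (mem_arcs eu); case: (e) => a b /= ab.
by rewrite (rel_time_arc hI hr ab); ring.
Qed.

Lemma feasible_sorted tau u :
  feasible I tau -> sorted <=%R (map (rel_departure tau u) (route I u)).
Proof.
move=> ft; rewrite sorted_map sorted_zip; apply/allP => -[e e'] h /=.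
by rewrite -subr_ge0 (rel_departure_next _ h) subr_ge0 (feas_next ft h).
Qed.

Lemma feasible_in_rtw tau u e :
  feasible I tau -> e \in route I u ->
  rtw_lo I r u <= rel_departure tau u e <= rtw_hi I r u.
Proof.
move=> ft eu; have srt := feasible_sorted u ft.
apply/andP; split.
  case E: (route I u) (eu) => [//|a s] _.
  apply: (@le_trans _ _ (rel_departure tau u a)).
    by rewrite /rtw_lo /rel_departure (route_first E) lerD2r (feas_first ft E).
  apply: (sorted_map_index srt) => //; first by rewrite E inE eqxx.
  by rewrite E /= eqxx.
case/lastP E: (route I u) (eu) => [//|s a] _.
have au : a \in route I u by rewrite E mem_rcons inE eqxx.
apply: (@le_trans _ _ (rel_departure tau u a)).
  apply: (sorted_map_index srt) => //.
  move: (route_uniq u) eu; rewrite E rcons_uniq => /andP[na _].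
  rewrite -index_mem size_rcons ltnS => h; apply: (leq_trans h).
  by rewrite -cats1 index_cat (negbTE na) leq_addr.
rewrite rtw_hiE /rel_departure -(route_last E).
move: (mem_arcs au) (feas_last ft E); case: (a) => c d /= cd.
by rewrite (rel_time_arc hI hr cd); lra.
Qed.

Lemma in_rtw_feasible tau :
  (forall u, sorted <=%R (map (rel_departure tau u) (route I u))) ->
  (forall u e, e \in route I u ->
     rtw_lo I r u <= rel_departure tau u e <= rtw_hi I r u) ->
  feasible I tau.
Proof.
move=> srt bnd; split.
- move=> u e s E; have /bnd/andP[+ _] : e \in route I u by rewrite E inE eqxx.
  by rewrite /rtw_lo /rel_departure (route_first E) lerD2r.
- move=> u e e' h; rewrite -subr_ge0 -(rel_departure_next _ h) subr_ge0.
  by move: (srt u); rewrite sorted_map sorted_zip => /allP/(_ _ h).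
- move=> u s e E.
  have eu : e \in route I u by rewrite E mem_rcons inE eqxx.
  move/bnd/andP: (eu) => [_]; rewrite rtw_hiE /rel_departure -(route_last E).
  move: (mem_arcs eu); case: (e) => c d /= cd.
  by rewrite (rel_time_arc hI hr cd); lra.
Qed.

Lemma stopsE tau u :
  stops I tau u = count (fun q => rel_departure tau u q.1 <
                                  rel_departure tau u q.2) (consecutive I u).
Proof.
apply: eq_in_count => -[e e'] h /=.
by rewrite -subr_gt0 -(rel_departure_next _ h) subr_gt0.
Qed.

(** * Buckets *)

Lemma size_endpoints : size (endpoints I r) = (2 * #|V|)%N.
Proof. by rewrite size_sort size_cat 2!size_map -!cardE mul2n addnn. Qed.

Lemma sorted_endpoints : sorted <=%R (endpoints I r).
Proof. exact: sort_le_sorted. Qed.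

Lemma nth_endpoints_le i j :
  (i <= j < 2 * #|V|)%N -> nth 0 (endpoints I r) i <= nth 0 (endpoints I r) j.
Proof.
move=> /andP[ij jn].
apply: (sorted_leq_nth le_trans le_refl 0 sorted_endpoints) => //;
  by rewrite inE size_endpoints ?(leq_ltn_trans ij).
Qed.

(** [b u e] is the index of a bucket of [u], for every arc [e] of its route.
    Buckets are given by natural numbers, so that [b] is total even when there
    is no slot at all. *)
Definition in_buckets (b : V -> N * N -> nat) : Prop :=
  forall u e, e \in route I u ->
    exists2 t, t \in buckets_of I r u & b u e = t :> nat.

Lemma card_visited b u : in_buckets b ->
  #|[set t in buckets_of I r u | (t : nat) \in map (b u) (route I u)]| =
  size (undup (map (b u) (route I u))).
Proof.
move=> hb; rewrite cardE -(size_map val); apply: perm_size.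
apply: uniq_perm; [|exact: undup_uniq|].
  by rewrite map_inj_uniq ?enum_uniq //; exact: val_inj.
move=> k; rewrite mem_undup; apply/mapP/idP => [[t]|].
  by rewrite mem_enum inE => /andP[_ h] ->.
move=> hk; case/mapP: (hk) => e eu kE; have [t tu bt] := hb _ _ eu.
exists t; last by rewrite kE.
by rewrite mem_enum; apply/setIdP; split; rewrite // -bt -kE.
Qed.

(** Rank of the bucket to which the relative time [x] is rounded: a lower end
    counts as passed at [x] itself, an upper end only after it.  A window that
    contains [x] thus has its lower end, but not its upper end, among the
    endpoints passed at [x], even when several endpoints equal [x].  The
    predecessor is taken because the bucket that follows [k] passed endpoints
    starts at the last of them, whose index is [k - 1]. *)
Definition bucket_index (x : R) : nat :=
  (count (fun v => rtw_lo I r v <= x)%R (enum V) +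
   count (fun v => rtw_hi I r v < x)%R (enum V)).-1.

Lemma bucket_index_mono x y : x <= y -> (bucket_index x <= bucket_index y)%N.
Proof.
move=> xy; have h1 : (count (fun v => rtw_lo I r v <= x)%R (enum V) <=
    count (fun v => rtw_lo I r v <= y)%R (enum V))%N.
  by apply: sub_count => v /= /le_trans; apply.
have h2 : (count (fun v => rtw_hi I r v < x)%R (enum V) <=
    count (fun v => rtw_hi I r v < y)%R (enum V))%N.
  by apply: sub_count => v /= /lt_le_trans; apply.
by rewrite /bucket_index; lia.
Qed.

Lemma count_endpoints (p : pred R) :
  count p (endpoints I r) = (count (fun v => p (rtw_lo I r v)) (enum V) +
                             count (fun v => p (rtw_hi I r v)) (enum V))%N.
Proof.
rewrite /endpoints; have /permP -> := permEl (perm_sort <=%R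
  ([seq rtw_lo I r v | v <- enum V] ++ [seq rtw_hi I r v | v <- enum V])).
by rewrite count_cat !count_map.
Qed.

(** The rounding does not depend on the vehicle, yet respects every window
    containing the time. *)
Lemma bucket_index_mem u x : rtw_lo I r u <= x <= rtw_hi I r u ->
  exists2 t, t \in buckets_of I r u & bucket_index x = t :> nat.
Proof.
move=> /andP[lox xhi]; set i := bucket_index x.
have uV : u \in enum V by rewrite mem_enum.
have hlo : (count (fun y => y < rtw_lo I r u)%R (endpoints I r) <
    count (fun v => rtw_lo I r v <= x)%R (enum V) +
    count (fun v => rtw_hi I r v < x)%R (enum V))%N.
  rewrite count_endpoints -addSn leq_add //.
    apply: (count_ltn (x := u)) => //; last by rewrite ltxx.
    by move=> v /ltW/le_trans; apply.
  by apply: sub_count => v /= /lt_le_trans; apply.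
have hhi : (count (fun v => rtw_lo I r v <= x)%R (enum V) +
    count (fun v => rtw_hi I r v < x)%R (enum V) <
    count (fun y => y <= rtw_hi I r u)%R (endpoints I r))%N.
  rewrite count_endpoints -addnS leq_add //.
    by apply: sub_count => v /= /le_trans; apply.
  apply: (count_ltn (x := u)) => //; last by rewrite -leNgt.
  by move=> v /ltW/le_trans; apply.
have hsz := count_size (fun y => y <= rtw_hi I r u)%R (endpoints I r).
rewrite size_endpoints in hsz.
have iS : (count (fun v => rtw_lo I r v <= x)%R (enum V) +
    count (fun v => rtw_hi I r v < x)%R (enum V) = i.+1)%N.
  by rewrite /i /bucket_index; lia.
rewrite iS in hlo hhi.
have it : (i < 2 * #|V| - 1)%N by lia.
exists (Ordinal it) => //; rewrite inE /slot_lo /slot_hi /=; apply/andP; split.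
  apply: nth_count_ge; first exact: sorted_endpoints.
  by rewrite size_endpoints; apply/andP; split; [exact: hlo | lia].
by apply: nth_count_le; [exact: sorted_endpoints | exact: hhi].
Qed.

End Routes.

(** * The discrete program *)

Section Program.

Variables (R : realFieldType) (N V : finType) (I : instance R N V) (r : N).
Hypothesis hI : valid_instance I.
Hypothesis hr : r \in gnodes I.
Hypothesis hsigma : sigma_l I <= sigma_f I.

Implicit Type s : dt_solution R N V.

Lemma binary_natb (z : R) : binary z -> exists b : bool, z = b%:R.
Proof. by case=> ->; [exists false | exists true]. Qed.

Lemma bucketsP u t : t \in buckets_of I r u -> t \in buckets I r.
Proof. by move=> tu; rewrite inE; apply/existsP; exists u. Qed.

(** The variables [dx] of [s] are the indicators of the assignment [b]. *)
Definition assigns s (b : V -> N * N -> nat) : Prop :=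
  forall u e t, e \in route I u -> t \in buckets_of I r u ->
    dx s u e t = (b u e == t :> nat)%:R.

(** Number of users of [e] that [b] assigns to bucket [k] on [e]. *)
Definition bucket_load (b : V -> N * N -> nat) e (k : nat) : nat :=
  #|[set v in users I e | b v e == k]|.

Lemma load_assigns s b e (t : slot V) :
  in_buckets I r b -> assigns s b ->
  load I r s e t = (bucket_load b e t)%:R.
Proof.
move=> hb hsb; rewrite /load /bucket_load -sumr_const.
rewrite [LHS]big_mkcond [RHS]big_mkcond; apply: eq_bigr => u _.
rewrite [in RHS]inE; case: (boolP (u \in users I e)) => //=.
rewrite mem_users => eu; case: ifP => [tu|tu].
  by rewrite hsb //; case: eqP.
case: eqP => // bt; have [t' t'u bt'] := hb _ _ eu.
have tt : t = t' by apply: val_inj; rewrite /= -bt -bt'.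
by rewrite tt t'u in tu.
Qed.

Lemma sum_group_saving b e : e \in arcs I -> in_buckets I r b ->
  \sum_(t in buckets I r) platoon_saving I e (bucket_load b e t) =
  group_saving I e (b^~ e).
Proof.
move=> he hb; apply: slots_group_saving => u; rewrite mem_users => eu.
by have [t tu bt] := hb _ _ eu; exists t; rewrite // (bucketsP tu).
Qed.

(** The bucket that [dt_departure] reads off [s]; as there, the default value is
    reached for no arc of the route when [s] is feasible. *)
Definition picked_bucket s u e : nat :=
  if [pick t in buckets_of I r u | dx s u e t == 1] is Some t then t else 0%N.

Lemma picked_bucketP s u e : dt_feasible I r s -> e \in route I u ->
  exists t, [/\ t \in buckets_of I r u, picked_bucket s u e = t,
    dt_departure I r s u e = slot_lo I r t - rel_time I e.1 r
    & forall t', t' \in buckets_of I r u -> dx s u e t' = (t == t')%:R].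
Proof.
move=> fs eu; rewrite /picked_bucket /dt_departure.
have sum1 := dt_assign fs eu; have bin t := dt_x_bin fs (t := t) eu.
case: pickP => [t /andP[tu /eqP x1]|none]; last first.
  move: sum1; rewrite big1 => [/eqP|t tu]; first by rewrite eq_sym oner_eq0.
  by case: (bin t tu) => // xt; move: (none t); rewrite tu xt eqxx.
exists t; split=> // t' t'u; case: eqP => [<- //|/eqP tt'].
have : \sum_(i in buckets_of I r u | i != t) dx s u e i == 0.
  by move: sum1; rewrite (bigD1 t) //= x1 => /eqP; rewrite -subr_eq0 addrAC subrr add0r.
rewrite psumr_eq0 => [/allP/(_ t')|i /andP[iu _]].
  by rewrite mem_index_enum t'u eq_sym tt' => /(_ isT)/eqP.
by case: (bin i iu) => ->.
Qed.

Lemma picked_in_buckets s : dt_feasible I r s -> in_buckets I r (picked_bucket s).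
Proof.
by move=> fs u e eu; have [t [tu bt _ _]] := picked_bucketP fs eu; exists t.
Qed.

Lemma picked_assigns s : dt_feasible I r s -> assigns s (picked_bucket s).
Proof.
move=> fs u e t' eu t'u; have [t [_ -> _ h]] := picked_bucketP fs eu.
by rewrite h.
Qed.

Lemma picked_sorted s u : dt_feasible I r s ->
  sorted leq (map (picked_bucket s u) (route I u)).
Proof.
move=> fs; rewrite sorted_map sorted_zip; apply/allP => -[e e'] h /=.
have [eu e'u] := mem_consecutive h.
have lt_ee' := consecutive_index (route_uniq hI u) h.
have [t [tu bt _ ht]] := picked_bucketP fs eu.
have [t' [t'u bt' _ ht']] := picked_bucketP fs e'u.
rewrite bt bt' leqNgt; apply/negP => t't.
have := dt_order fs eu e'u lt_ee' tu t'u t't.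
by rewrite ht // ht' // !eqxx subrr ler10.
Qed.

(** The relative departure is the lower end of the picked bucket. *)
Lemma rel_departure_dt s u e : dt_feasible I r s -> e \in route I u ->
  rel_departure I r (dt_departure I r s) u e =
  nth 0 (endpoints I r) (picked_bucket s u e).
Proof.
move=> fs eu; have [t [_ -> hd _]] := picked_bucketP fs eu.
by rewrite /rel_departure hd subrK.
Qed.

Lemma picked_bucket_lt s u e : dt_feasible I r s -> e \in route I u ->
  ((picked_bucket s u e).+1 < 2 * #|V|)%N.
Proof.
move=> fs eu; have [t [_ -> _ _]] := picked_bucketP fs eu.
by have := ltn_ord t; lia.
Qed.

Lemma dt_departure_mono s u e e' : dt_feasible I r s ->
  e \in route I u -> e' \in route I u ->
  (picked_bucket s u e <= picked_bucket s u e')%N ->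
  rel_departure I r (dt_departure I r s) u e <=
  rel_departure I r (dt_departure I r s) u e'.
Proof.
move=> fs eu e'u h; rewrite !rel_departure_dt //; apply: nth_endpoints_le.
by rewrite h ltnW // picked_bucket_lt.
Qed.

Lemma dt_departure_feasible s :
  dt_feasible I r s -> feasible I (dt_departure I r s).
Proof.
move=> fs; apply: (in_rtw_feasible hI hr) => [u|u e eu].
  rewrite sorted_map sorted_zip; apply/allP => -[e e'] h /=.
  have [eu e'u] := mem_consecutive h.
  apply: dt_departure_mono => //.
  have := picked_sorted u fs.
  by rewrite sorted_map sorted_zip => /allP/(_ _ h).
rewrite rel_departure_dt //; have [t [+ bt _ _]] := picked_bucketP fs eu.
rewrite inE /slot_lo /slot_hi bt => /andP[-> /=]; apply: le_trans.
by apply: nth_endpoints_le; rewrite leqnSn -bt picked_bucket_lt.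
Qed.

(** The constraints force [dy = 1] as soon as the bucket is used, and [dw >= 0]
    forces [dy = 0] otherwise; [dy'] may be 1 only for a load of at least 2. *)
Lemma dt_saving_le s e t : dt_feasible I r s -> e \in arcs I ->
  t \in buckets I r ->
  sigma_l I * cost I e * dy' s e t + sigma_f I * cost I e * dw s e t <=
  platoon_saving I e (bucket_load (picked_bucket s) e t).
Proof.
move=> fs he ht.
have hload := load_assigns e t (picked_in_buckets fs) (picked_assigns fs).
have w0 := dt_w_ge0 fs he ht; have wE := dt_trailing fs he ht.
have y2 := dt_platoon fs he ht.
have [y yE] := binary_natb (dt_y_bin fs he ht).
have [y' y'E] := binary_natb (dt_y'_bin fs he ht).
rewrite hload yE in wE; rewrite hload y'E in y2.
rewrite wE in w0 *; rewrite y'E.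
have yl : (0 < bucket_load (picked_bucket s) e t)%N -> y.
  rewrite card_gt0 => /set0Pn[u]; rewrite inE => /andP[ue /eqP bt].
  move: (ue); rewrite mem_users => eu.
  have [t' [t'u bt' _ h]] := picked_bucketP fs eu.
  have tt' : t' = t by apply: val_inj; rewrite /= -bt -bt'.
  have := dt_used fs he ue t'u; rewrite h // eqxx tt' yE.
  by case: (y); rewrite // ler10.
have c0 := ltW (cost_gt0 hI he).
have l0 : 0 <= sigma_l I * cost I e by rewrite mulr_ge0 // ltW // sigma_l_gt0.
rewrite /platoon_saving; move: w0 y2 yl.
case: (bucket_load _ e t) => [|[|n]] w0 y2 yl /=.
- by move: w0 y2; case: (y); case: (y') => /=; lra.
- by move: w0 y2; rewrite yl //; case: (y') => /=; lra.
- rewrite yl // subn1 /= -[in X in X - _]natr1 addrK lerD2r.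
  by case: (y') => /=; rewrite ?mulr1 ?mulr0.
Qed.

Lemma platoon_saving_indicators e n :
  sigma_l I * cost I e * (1 < n)%N%:R +
  sigma_f I * cost I e * (n%:R - (0 < n)%N%:R) = platoon_saving I e n.
Proof.
rewrite /platoon_saving; case: n => [|[|n]] /=.
- by rewrite subrr !mulr0 addr0.
- by rewrite subrr !mulr0 addr0.
- by rewrite mulr1 subn1 /= -[in X in X - _]natr1 addrK.
Qed.

(** Number of vehicles with a nonempty route.  A vehicle with an empty route
    makes no stop but may visit no bucket, which the objective of the program
    then counts as [-1] stop; hence the correction term
    [alpha_eng * (#|V| - moving)] in both comparisons below. *)
Definition moving : nat := \sum_(u : V) (route I u != [::]).

Lemma dt_objective_le s : dt_feasible I r s ->
  dt_objective I r s <= objective I (dt_departure I r s)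
    + alpha_eng I * (#|V|%:R - moving%:R).
Proof.
move=> fs; set tau := dt_departure I r s.
have hb := picked_in_buckets fs.
rewrite /dt_objective /objective -addrA; apply: lerD.
  apply: ler_sum => e he; rewrite platoons_group_saving.
  apply: le_trans (group_saving_coarser hI hsigma (f := picked_bucket s ^~ e) he _).
    by rewrite -sum_group_saving //; apply: ler_sum => t; exact: dt_saving_le.
  move=> u v; rewrite !mem_users => eu ev /= bE.
  apply: (addIr (rel_time I e.1 r)).
  rewrite -[LHS]/(rel_departure I r tau u e) -[RHS]/(rel_departure I r tau v e).
  by rewrite !rel_departure_dt // bE.
suff key : (\sum_u stops I tau u)%N%:R + moving%:R <=
    \sum_(u : V) \sum_(t in buckets_of I r u) dp s u t.
  have := ler_wpM2l (alpha_eng_ge0 hI) key.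
  by rewrite sumrB sumr_const -[#|_|]/(#|V|); lra.
(* The number of distinct buckets along the route lies between the two. *)
rewrite /moving !natr_sum -big_split /=.
apply: ler_sum => u _.
apply: (@le_trans _ _ (size (undup (map (picked_bucket s u) (route I u))))%:R).
  rewrite -natrD ler_nat (stopsE hI hr).
  apply: leq_trans (increases_size_undup (picked_sorted u fs)).
  rewrite leq_add2r; apply: leq_in_count => -[e e'] h /=.
  have [eu e'u] := mem_consecutive h.
  by rewrite ltnNge; apply: contraTN => ?; rewrite -leNgt dt_departure_mono.
rewrite -(card_visited u hb) -sumr_const.
rewrite [leLHS]big_mkcond [leRHS]big_mkcond; apply: ler_sum => t _; rewrite inE.
case: (boolP (t \in buckets_of I r u)) => //= tu.
case: ifP => [/mapP[e eu tE]|_]; last by case: (dt_p_bin fs tu) => ->.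
apply: le_trans (dt_visit fs eu tu).
by rewrite picked_assigns // -tE eqxx.
Qed.

(** The solution of the program induced by an assignment [b]: a bucket is
    visited, used or a platoon precisely when [b] makes it so. *)
Definition dt_of (b : V -> N * N -> nat) : dt_solution R N V :=
  DTSolution (fun u e t => (b u e == t :> nat)%:R)
    (fun u t => ((t : nat) \in map (b u) (route I u))%:R)
    (fun e t => (0 < bucket_load b e t)%N%:R)
    (fun e t => (1 < bucket_load b e t)%N%:R)
    (fun e t => (bucket_load b e t)%:R - (0 < bucket_load b e t)%N%:R).

Lemma dt_of_assigns b : assigns (dt_of b) b.
Proof. by []. Qed.

Lemma dt_of_feasible b : in_buckets I r b ->
  (forall u, sorted leq (map (b u) (route I u))) -> dt_feasible I r (dt_of b).
Proof.
move=> hb srt; have hl e t := load_assigns e t hb (@dt_of_assigns b).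
have bin (c : bool) : binary (c%:R : R) by case: c; [right | left].
split=> //=.
- move=> u e eu; have [t tu bt] := hb _ _ eu.
  rewrite (bigD1 t) //= bt eqxx big1 ?addr0 // => t' /andP[_ /eqP tt'].
  by case: eqP => // /val_inj /esym.
- move=> u e e' t t' eu e'u ee' tu t'u t't.
  have := sorted_map_index (srt u) eu e'u (ltnW ee').
  case: (b u e' =P _) => [->|_]; last by case: eqP; rewrite ?subrr ?subr0 /=.
  by case: (b u e =P _) => [->|_ _]; rewrite ?subr0 // leEnat leqNgt t't.
- move=> u e t eu tu; case: eqP => [<-|_] //.
  by rewrite (map_f (b u) eu).
- move=> e t he ht; rewrite hl -natrM ler_nat.
  by case: (bucket_load b e t) => [|[|n]].
- move=> e u t he ue tu; case: eqP => [bt|_] //.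
  rewrite ler_nat lt0b card_gt0; apply/set0Pn; exists u.
  by rewrite inE ue; apply/eqP.
- by move=> e t he ht; rewrite hl.
- by move=> e t he ht; case: (bucket_load b e t) => [|n]; rewrite subr_ge0 ler_nat.
Qed.

Lemma feasible_dt tau : feasible I tau ->
  exists2 s, dt_feasible I r s &
    objective I tau + alpha_eng I * (#|V|%:R - moving%:R) <= dt_objective I r s.
Proof.
move=> ft; pose b u e := bucket_index I r (rel_departure I r tau u e).
have hb : in_buckets I r b.
  by move=> u e eu; apply/bucket_index_mem/feasible_in_rtw.
have srt u : sorted leq (map (b u) (route I u)).
  move: (feasible_sorted hI hr u ft); rewrite !sorted_map.
  by apply: sub_sorted => e e' /=; exact: bucket_index_mono.
exists (dt_of b); first exact: dt_of_feasible.
rewrite /dt_objective /objective -addrA; apply: lerD.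
  apply: ler_sum => e he; rewrite platoons_group_saving.
  under [leRHS]eq_bigr => t _ do rewrite /= platoon_saving_indicators.
  rewrite sum_group_saving //; apply: group_saving_coarser => // u v _ _ /=.
  by rewrite /b /rel_departure => ->.
suff key : \sum_(u : V) \sum_(t in buckets_of I r u) dp (dt_of b) u t <=
    (\sum_u stops I tau u)%N%:R + moving%:R.
  have := ler_wpM2l (alpha_eng_ge0 hI) key.
  by rewrite sumrB sumr_const -[#|_|]/(#|V|); lra.
rewrite /moving !natr_sum -big_split /=.
apply: ler_sum => u _.
apply: (@le_trans _ _ (size (undup (map (b u) (route I u))))%:R); last first.
  rewrite -natrD ler_nat (stopsE hI hr).
  apply: leq_trans (size_undup_changes (b u) (route I u)) _.
  rewrite leq_add2r; apply: leq_in_count => -[e e'] h /= bb.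
  move: (feasible_sorted hI hr u ft); rewrite sorted_map sorted_zip.
  move=> /allP/(_ _ h) /= le_ee'; rewrite lt_neqAle le_ee' andbT.
  by apply: contraNN bb => /eqP E; rewrite /b E.
rewrite -(card_visited u hb) -sumr_const.
rewrite [leLHS]big_mkcond [leRHS]big_mkcond; apply: ler_sum => t _; rewrite [in leRHS]inE.
by case: (t \in buckets_of I r u) => //=; case: ifP.
Qed.

End Program.

Theorem proposition4 (R : realFieldType) (N V : finType)
    (I : instance R N V) (r : N) (s : dt_solution R N V)
    (hI : valid_instance I)
    (hsigma : sigma_l I <= sigma_f I)
    (hr : r \in gnodes I)
    (hs : dt_optimal I r s) :
  optimal I (dt_departure I r s).
Proof.
have [fs opt] := hs; split; first exact: dt_departure_feasible.
move=> tau /(feasible_dt hI hr hsigma)[s' fs' le_s'].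
have := dt_objective_le hI hr hsigma fs.
by have := opt s' fs'; lra.
Qed.
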